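(* Let $0<a\le1/4$, $b>1$, $\delta>0$, let $u$ be the 2-peakon solution of the Novikov equation on the line with initial profile $-(b+\delta)e^{-|x+a|}+be^{-|x-a|}$ and lifespan $T$ described in the context, and let $v_T(x)=w_Te^{-|x-q_T|}$. Then for every $s<5/4$, $$\lim_{t\to T^-}\|u(t)-v_T\|_{H^s(\mathbb{R})}=0.$$
   Context: The 2-peakon is $u(x,t)=p_1(t)e^{-|x-q_1(t)|}+p_2(t)e^{-|x-q_2(t)|}$, where, with $q=q_2-q_1$, $(q_1,q_2,p_1,p_2)$ is the unique smooth solution of $q_1'=(p_1+p_2e^{-q})^2$, $q_2'=(p_1e^{-q}+p_2)^2$, $p_1'=-p_1p_2(p_1+p_2e^{-q})e^{-q}$, $p_2'=p_1p_2(p_1e^{-q}+p_2)e^{-q}$, with $q_1(0)=-a$, $q_2(0)=a$, $p_1(0)=-(b+\delta)$, $p_2(0)=b$, on the interval $[0,T)$, where $T<\infty$ is the lifespan: $q>0$ on $[0,T)$ and $q(t)\to0$ as $t\to T^-$. Further, $w_T=\lim_{t\to T^-}(p_1(t)+p_2(t))=-\big(\delta^2+2b(b+\delta)(1-e^{-2a})\big)^{1/2}$ and $q_T=\lim_{t\to T^-}q_1(t)=\lim_{t\to T^-}q_2(t)$. The norm is $\|f\|_{H^s}^2=\int_{\mathbb{R}}(1+\xi^2)^s|\widehat f(\xi)|^2d\xi$. *)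

(* Defs.v *)
(* MathComp-Analysis *)
From HB Require Import structures.
From mathcomp Require Import all_boot all_order all_algebra.
From mathcomp Require Import complex.
From mathcomp Require Import all_classical all_reals all_analysis.
Set Implicit Arguments.
Unset Strict Implicit.
Unset Printing Implicit Defensive.
Import Order.TTheory GRing.Theory Num.Theory.
Import numFieldNormedType.Exports.
Local Open Scope classical_set_scope.
Local Open Scope ring_scope.
Local Open Scope complex_scope.

(* The difference quotient is restricted to I, so the derivative is one-sided
   at an endpoint of I. *)
Definition has_derivative_in (R : realType) (I : set R) (f : R -> R)
    (t l : R) : Prop :=
  (f r - f t) / (r - t) @[r --> within I t^'] --> l.

(* Smoothness of q1, q2, p1, p2 on [0, T) follows from the equations. *)
Record is_peakon_pair (R : realType) (a b delta T : R)
    (q1 q2 p1 p2 : R -> R) : Prop := IsPeakonPair {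
  peakon_lifespan_gt0 : 0 < T ;
  peakon_q1_0 : q1 0 = - a ;
  peakon_q2_0 : q2 0 = a ;
  peakon_p1_0 : p1 0 = - (b + delta) ;
  peakon_p2_0 : p2 0 = b ;
  peakon_dq1 : forall t : R, 0 <= t < T ->
    has_derivative_in `[0, T[ q1 t
      ((p1 t + p2 t * expR (- (q2 t - q1 t))) ^+ 2) ;
  peakon_dq2 : forall t : R, 0 <= t < T ->
    has_derivative_in `[0, T[ q2 t
      ((p1 t * expR (- (q2 t - q1 t)) + p2 t) ^+ 2) ;
  peakon_dp1 : forall t : R, 0 <= t < T ->
    has_derivative_in `[0, T[ p1 t
      (- p1 t * p2 t * (p1 t + p2 t * expR (- (q2 t - q1 t)))
       * expR (- (q2 t - q1 t))) ;
  peakon_dp2 : forall t : R, 0 <= t < T ->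
    has_derivative_in `[0, T[ p2 t
      (p1 t * p2 t * (p1 t * expR (- (q2 t - q1 t)) + p2 t)
       * expR (- (q2 t - q1 t))) ;
  peakon_gap_gt0 : forall t : R, 0 <= t < T -> 0 < q2 t - q1 t ;
  peakon_gap_cvg0 : (q2 t - q1 t) @[t --> T^'-] --> (0 : R)
}.

Definition peakon2 (R : realType) (q1 q2 p1 p2 : R -> R) (t x : R) : R :=
  p1 t * expR (- `|x - q1 t|) + p2 t * expR (- `|x - q2 t|).

Definition peakon_wT (R : realType) (T : R) (p1 p2 : R -> R) : R :=
  lim ((p1 t + p2 t) @[t --> T^'-]).

Definition peakon_qT (R : realType) (T : R) (q1 : R -> R) : R :=
  lim (q1 t @[t --> T^'-]).

Definition limit_profile (R : realType) (T : R) (q1 p1 p2 : R -> R)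
    (x : R) : R :=
  peakon_wT T p1 p2 * expR (- `|x - peakon_qT T q1|).

Definition Cintegral (R : realType) (g : R -> R[i]) : R[i] :=
  (Rintegral (@lebesgue_measure R) setT (fun x => complex.Re (g x))) +i*
  (Rintegral (@lebesgue_measure R) setT (fun x => complex.Im (g x))).

(* Meaningful for integrable f; normalized without a factor of 2 pi. *)
Definition fourier (R : realType) (f : R -> R) (xi : R) : R[i] :=
  Cintegral (fun x => (f x)%:C * (cos (x * xi) -i* sin (x * xi))).

Definition Hs_norm (R : realType) (s : R) (f : R -> R) : \bar R :=
  ((\int[@lebesgue_measure R]_(xi in setT)
      ((1 + xi ^+ 2) `^ s * Normc.normc (fourier f xi) ^+ 2)%:E) `^ (2^-1))%E.

(* Main.v *)
(* Since the Fourier transform of e^{-|x-q|} is 2 e^{-i q xi} / (1 + xi^2), the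
   squared H^s norm is the integral of 4 (1 + xi^2)^{s-2} times
     |p1 e^{-i q1 xi} + p2 e^{-i q2 xi} - w_T e^{-i q_T xi}|^2,
   in which the sum of three exponentials equals
     (p1 + p2 - w_T) e^{-i q1 xi} + w_T (e^{-i q1 xi} - e^{-i q_T xi})
       + p2 (e^{-i q2 xi} - e^{-i q1 xi}).
   As |e^{ix} - e^{iy}|^2 <= 4 |x - y|^{2 theta} for 0 <= theta <= 1, the norm tends
   to 0 as soon as s + theta < 3/2 (integrability), p1 + p2 -> w_T, q1 -> q_T and
   p2^2 q^{2 theta} -> 0, where q = q2 - q1.
   With E = e^{-q}, the system conserves H = p1^2 + p2^2 + 2 p1 p2 E and
   K = (p1 p2)^2 (1 - E^2). The second law gives p1 p2 = O(q^{-1/2}), so that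
   (p1 + p2)^2 = H + 2 p1 p2 (1 - E) -> H > 0 and p2^2 = O(q^{-1/2}); hence every
   theta > 1/4 is admissible, which leaves room exactly when s < 5/4. *)

Require Import Defs.
From mathcomp Require Import all_boot all_order all_algebra.
From mathcomp Require Import complex ring lra.
From mathcomp Require Import all_classical all_reals all_analysis.
From mathcomp Require Import measurable_realfun.
Import Order.TTheory GRing.Theory Num.Theory.
Import numFieldNormedType.Exports.
Local Open Scope classical_set_scope.
Local Open Scope ring_scope.

(** * Cosine integrals against a peak [expR (- |x - q|)] *)

(* Integrating 1 + cos instead of cos keeps the integrand nonnegative, as the
   improper form of the fundamental theorem of calculus requires. *)
Lemma expR_1Dcos_integral_half_line (R : realType) (xi psi : R) :
  (\int[@lebesgue_measure R]_(y in `[0%R, +oo[)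
     (expR (- y) * (1 + cos (y * xi + psi)))%:E
   = (1 + (cos psi - xi * sin psi) / (1 + xi ^+ 2))%:E)%E.
Proof.
have h0 : 1 + xi ^+ 2 != 0 by rewrite gt_eqF// ltr_wpDr// sqr_ge0.
(* The oscillating part of [F] is the real part of e^{(-1 + i xi) y + i psi} / (-1 + i xi). *)
pose F (y : R) := - (expR (- y) * (1 + (cos (y * xi + psi)
   - xi * sin (y * xi + psi)) / (1 + xi ^+ 2))).
have dF (y : R) : is_derive y 1 F (expR (- y) * (1 + cos (y * xi + psi))).
  apply: is_derive_eq; rewrite /GRing.scale/=.
  by field.
rewrite (@ge0_continuous_FTC2y _ _ F 0 0).
- rewrite /F /= oppr0 expR0 [0 * xi]mul0r [0 + psi]add0r mul1r -EFinB; congr EFin; ring.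
- move=> x _; rewrite mulr_ge0 ?expR_ge0// -lerBlDl sub0r cos_geN1//.
- apply: continuous_subspaceT => x.
  apply: differentiable_continuous.
  exact/derivable1_diffP/ex_derive.
- have e0 : expR (- y) @[y --> +oo] --> (0 : R) by exact: cvgr_expR.
  (* [F] vanishes at infinity: |cos - xi sin| <= 1 + |xi| and 1 / (1 + xi^2) <= 1. *)
  pose C := 1 + (1 + `|xi|).
  have bF y : `|F y| <= C * expR (- y).
    rewrite /F normrN normrM (ger0_norm (expR_ge0 _)) mulrC ler_wpM2r ?expR_ge0//.
    rewrite (le_trans (ler_normD _ _))// normr1 lerD2l normrM.
    rewrite -[leRHS]mulr1 ler_pM//.
      rewrite (le_trans (ler_normB _ _))// lerD ?cos_max// normrM.
      by rewrite ler_piMr// sin_max.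
    by rewrite normfV ger0_norm ?addr_ge0 ?sqr_ge0// invf_le1 ?lerDl ?sqr_ge0// ltr_wpDr// sqr_ge0.
  apply: (@squeeze_cvgr _ _ _ _ (fun y => - (C * expR (- y))) (fun y => C * expR (- y))).
  + by apply: nearW => y; rewrite -ler_norml.
  + by rewrite -oppr0; apply: cvgN; rewrite -(mulr0 C); apply: cvgM => //; exact: cvg_cst.
  + by rewrite -(mulr0 C); apply: cvgM => //; exact: cvg_cst.
- move=> x _; exact: ex_derive.
- apply: cvg_at_right_filter; apply: differentiable_continuous.
  exact/derivable1_diffP/ex_derive.
- by move=> x _; rewrite derive1E derive_val.
Qed.

Lemma continuous_expR_norm_1Dcos (R : realType) (q xi phi : R) :
  continuous (fun x : R => expR (- `|x - q|) * (1 + cos (x * xi + phi))).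
Proof.
move=> x; apply: cvgM.
  apply: (@continuous_comp _ _ _ (fun x : R => - `|x - q|) expR); last exact: continuous_expR.
  apply: cvgN; apply: (@continuous_comp _ _ _ (fun x : R => x - q) Num.norm); last exact: norm_continuous.
  by apply: cvgB => //; exact: cst_continuous.
apply: cvgD; first exact: cst_continuous.
apply: differentiable_continuous; exact/derivable1_diffP/ex_derive.
Qed.

(** The negative half-line, reflected, gives the half-line integral with [- xi] for [xi], so the
    [sin psi] terms cancel. The free phase absorbs a later translation of the peak and, at [pi / 2],
    produces the sine integrals. *)
Lemma expR_norm_1Dcos_integral (R : realType) (xi psi : R) :
  (\int[@lebesgue_measure R]_x (expR (- `|x|) * (1 + cos (x * xi + psi)))%:E
   = (2 + 2 * cos psi / (1 + xi ^+ 2))%:E)%E.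
Proof.
pose f (x : R) := expR (- `|x|) * (1 + cos (x * xi + psi)).
have f0 x : 0 <= f x by rewrite mulr_ge0 ?expR_ge0// -lerBlDl sub0r cos_geN1.
have cf : continuous f.
  by have := @continuous_expR_norm_1Dcos R 0 xi psi; under eq_fun do rewrite subr0.
have mf : measurable_fun setT f by exact: continuous_measurable_fun.
rewrite -(setUv `[(0:R), +oo[%classic) ge0_integral_setU//=; last 3 first.
- by rewrite setCitvr; exact: measurable_itv.
- by apply/measurable_EFinP; rewrite setUv.
- exact/disj_setPCl.
rewrite setCitvr integral_itv_bndo_bndc; last exact/measurable_EFinP/measurable_funTS.
rewrite -{2}oppr0 ge0_integration_by_substitutionNy; last 2 first.
- exact: continuous_subspaceT.
- by move=> x _; exact: f0.
transitivity (\int[@lebesgue_measure R]_(y in `[0%R, +oo[) (expR (- y) * (1 + cos (y * xi + psi)))%:E +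
  \int[@lebesgue_measure R]_(y in `[0%R, +oo[) (expR (- y) * (1 + cos (y * (- xi) + psi)))%:E)%E.
  congr (_ + _)%E; apply: eq_integral => y; rewrite inE/= in_itv/= andbT => y0.
    by rewrite ger0_norm.
  by rewrite /f /= normrN ger0_norm// mulNr mulrN.
rewrite !expR_1Dcos_integral_half_line -EFinD sqrrN; congr EFin.
by field; rewrite gt_eqF// ltr_wpDr// sqr_ge0.
Qed.

Lemma expR_norm_sub_1Dcos_integral (R : realType) (q xi phi : R) :
  (\int[@lebesgue_measure R]_x (expR (- `|x - q|) * (1 + cos (x * xi + phi)))%:E
   = (2 + 2 * cos (q * xi + phi) / (1 + xi ^+ 2))%:E)%E.
Proof.
have D : (fun x : R => x + q)^`()%classic = cst 1.
  by apply/funext => x; rewrite derive1E derive_val addr0.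
rewrite (@increasing_ge0_integration_by_substitutionT _ (fun x => x + q)).
- rewrite -expR_norm_1Dcos_integral; apply: eq_integral => x _.
  by rewrite D /= fctE /= mulr1 addrK mulrDl -addrA.
- by move=> x y; rewrite ltrD2r.
- by rewrite D; exact: cst_continuous.
- by rewrite D; exact: is_cvg_cst.
- by rewrite D; exact: is_cvg_cst.
- by [].
- exact: cvg_addrr_Ny.
- exact: cvg_addrr.
- exact: continuous_expR_norm_1Dcos.
- by move=> x; rewrite mulr_ge0 ?expR_ge0// -lerBlDl sub0r cos_geN1.
Qed.

Lemma expR_norm_integral (R : realType) (q : R) :
  (\int[@lebesgue_measure R]_x (expR (- `|x - q|))%:E = 2%:E)%E.
Proof.
(* At frequency 0 and phase 0 the factor 1 + cos is 2, so twice the integral is 4. *)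
have := expR_norm_sub_1Dcos_integral R q 0 0.
under eq_integral do rewrite mulr0 addr0 cos0 -[1 + 1]/(2 : R) mulrC EFinM.
rewrite mulr0 addr0 cos0 ge0_integralZl_EFin//; last first.
- apply/measurable_EFinP; apply: continuous_measurable_fun => x.
  (* At frequency 0 and phase [pi / 2] the factor 1 + cos is 1, which leaves the bare
     exponential. *)
  have := @continuous_expR_norm_1Dcos R q 0 (pi / 2) x.
  by under eq_fun do rewrite mulr0 add0r cos_pihalf addr0 mulr1.
rewrite expr0n/= addr0 mulr1 divr1 => h.
have : (2^-1%:E * (2%:E * \int[@lebesgue_measure R]_x (expR (- `|x - q|))%:E) = 2^-1%:E * (2 + 2)%:E)%E.
  by rewrite h.
rewrite muleA -EFinM mulVf// mul1e => ->; rewrite -EFinM; congr EFin; lra.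
Qed.

Lemma expR_norm_integrable (R : realType) (q : R) :
  (@lebesgue_measure R).-integrable setT (fun x => (expR (- `|x - q|))%:E).
Proof.
apply/integrableP; split.
  apply/measurable_EFinP; apply: continuous_measurable_fun => x.
  have := @continuous_expR_norm_1Dcos R q 0 (pi / 2) x.
  by under eq_fun do rewrite mulr0 add0r cos_pihalf addr0 mulr1.
under eq_integral do rewrite abse_EFin ger0_norm ?expR_ge0//.
by rewrite expR_norm_integral ltry.
Qed.

Lemma expR_norm_cos_integrable (R : realType) (q xi phi : R) :
  (@lebesgue_measure R).-integrable setT
    (fun x => (expR (- `|x - q|) * cos (x * xi + phi))%:E).
Proof.
apply: (le_integrable _ _ _ (expR_norm_integrable R q)) => //.
  apply/measurable_EFinP; apply: continuous_measurable_fun => x.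
  have -> : (fun x : R => expR (- `|x - q|) * cos (x * xi + phi)) =
    (fun x : R => expR (- `|x - q|) * (1 + cos (x * xi + phi)) - expR (- `|x - q|) * (1 + cos (x * 0 + pi / 2))).
    by apply/funext => y; rewrite mulr0 add0r cos_pihalf; ring.
  by apply: cvgB; exact: continuous_expR_norm_1Dcos.
move=> x _; rewrite lee_fin normrM (ger0_norm (expR_ge0 _)).
by rewrite ler_piMr ?expR_ge0// cos_max.
Qed.

Lemma expR_norm_cos_Rintegral (R : realType) (q xi phi : R) :
  Rintegral (@lebesgue_measure R) setT (fun x => expR (- `|x - q|) * cos (x * xi + phi))
  = 2 * cos (q * xi + phi) / (1 + xi ^+ 2).
Proof.
have := expR_norm_sub_1Dcos_integral R q xi phi.
under eq_integral do rewrite mulrDr mulr1 EFinD.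
rewrite integralD//; [|exact: expR_norm_integrable|exact: expR_norm_cos_integrable].
rewrite expR_norm_integral addeC => /(congr1 (fun z => z - 2%:E)%E).
by rewrite addeK// -EFinB addrAC subrr add0r /Rintegral => ->.
Qed.

(** * Continuity and integrability of powers of 1 + x^2 *)

Lemma is_derive_powR (R : realType) (e x : R) : 0 < x ->
  is_derive x 1 (@powR R ^~ e) (e * x `^ (e - 1)).
Proof.
move=> x0; have xI : x \in `]0, +oo[ by rewrite in_itv/= andbT.
by apply: DeriveDef; [exact: derivable_powR|rewrite -derive1E powR_derive1].
Qed.

Lemma continuous_powRl (R : realType) (e x : R) : 0 < x -> {for x, continuous (@powR R ^~ e)}.
Proof.
move=> x0; apply: differentiable_continuous; apply/derivable1_diffP.
by have := is_derive_powR R e x x0 => ?; exact: ex_derive.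
Qed.

Lemma continuous_1Dsqr_powR (R : realType) (e : R) :
  continuous (fun x : R => (1 + x ^+ 2) `^ e).
Proof.
move=> x.
apply: (@continuous_comp _ _ _ (fun x : R => 1 + x ^+ 2) (@powR R ^~ e)).
  by apply: cvgD; [exact: cvg_cst|exact: exprn_continuous].
by apply: continuous_powRl; rewrite ltr_pwDl// sqr_ge0.
Qed.

Lemma powRN_1D_integral_lty (R : realType) (e : R) : 1 < e ->
  (\int[@lebesgue_measure R]_(x in `[0%R, +oo[) ((1 + x) `^ (- e))%:E < +oo)%E.
Proof.
move=> e1; pose F (x : R) := (1 - e)^-1 * (1 + x) `^ (1 - e).
have dF (x : R) : 0 <= x -> is_derive x 1 F ((1 + x) `^ (- e)).
  move=> x0; have x1 : 0 < 1 + x by rewrite ltr_pwDl.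
  have d : is_derive (1 + x) 1 (@powR R ^~ (1 - e)) ((1 - e) * (1 + x) `^ (1 - e - 1)).
    exact: is_derive_powR.
  have d1 : is_derive x 1 (fun x : R => 1 + x) 1.
    by apply: is_derive_eq; rewrite add0r mulr1.
  have d2 : is_derive x 1 (fun x : R => (1 + x) `^ (1 - e)) _ := is_derive1_comp d d1.
  apply: is_derive_eq; rewrite /GRing.scale/= mulr1 mulKf; last by rewrite subr_eq0 lt_eqF.
  by congr (_ `^ _); ring.
have cF (x : R) : 0 <= x -> {for x, continuous F}.
  move=> /dF d; apply: differentiable_continuous; apply/derivable1_diffP; exact: ex_derive.
rewrite (@ge0_continuous_FTC2y _ _ F 0 0) ?ltry//.
- by move=> x _; rewrite powR_ge0.
- apply: continuous_in_subspaceT => x; rewrite inE/= in_itv/= andbT => x0.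
  have x1 : 0 < 1 + x by rewrite ltr_pwDl.
  apply: (@continuous_comp _ _ _ (fun x : R => 1 + x) (@powR R ^~ (- e))); last exact: continuous_powRl.
  by apply: cvgD => //; exact: cvg_cst.
- rewrite /F -[X in _ --> X](mulr0 (1 - e)^-1); apply: cvgM; first exact: cvg_cst.
  (* (1 + x)^{1 - e} is the positive power e - 1 of (1 + x)^{-1}, which tends to 0 from the
     right. *)
  have h : (1 + x)^-1 @[x --> +oo] --> (0 : R)^'+.
    have h0 : (1 + x)^-1 @[x --> +oo] --> (0 : R).
      apply/gtr0_cvgV0; last exact: cvg_addrl.
      by near=> x; rewrite ltr_pwDl//; near: x; apply: nbhs_pinfty_ge; rewrite num_real.
    have hpos : \forall x \near +oo, 0 < (1 + x : R)^-1.
      by near=> x; rewrite invr_gt0 ltr_pwDl//; near: x; apply: nbhs_pinfty_ge; rewrite num_real.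
    by move=> A /h0; apply: filterS2 hpos => x hx /=; exact.
  have e0 : 0 < e - 1 by rewrite subr_gt0.
  have := cvg_trans (cvg_app (fun y : R => y `^ (e - 1)) h) (@powR_cvg0 _ _ e0).
  apply: cvg_trans; apply: near_eq_cvg; near=> x.
  have x1 : 0 <= 1 + x by rewrite addr_ge0//; near: x; apply: nbhs_pinfty_ge; rewrite num_real.
  by rewrite -powR_inv1// -powRrM; congr (_ `^ _); ring.
- by move=> x /ltW /dF d; exact: ex_derive.
- by apply: cvg_at_right_filter; exact: cF.
- move=> x; rewrite in_itv/= andbT => /ltW /dF d.
  by rewrite derive1E derive_val.
Unshelve. all: by end_near. Qed.

(** By evenness the half-line suffices; there (1 + x)^2 <= 2 (1 + x^2) bounds the integrand by 2^r
    (1 + x)^{-2r}, and 2r > 1. *)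
Lemma powRN_1Dsqr_integral_lty (R : realType) (r : R) : 2^-1 < r ->
  (\int[@lebesgue_measure R]_x ((1 + x ^+ 2) `^ (- r))%:E < +oo)%E.
Proof.
move=> r2.
have pos (x : R) : 0 < 1 + x ^+ 2 by rewrite ltr_pwDl// sqr_ge0.
have cf : continuous (fun x : R => (1 + x ^+ 2) `^ (- r)) by exact: continuous_1Dsqr_powR.
rewrite ge0_symfun_integralT//; last 2 first.
- by move=> x; rewrite powR_ge0.
- by move=> x /=; rewrite sqrrN.
rewrite -set_itvcy lte_mul_pinfty ?lee_fin//.
apply: (@le_lt_trans _ _ (\int[@lebesgue_measure R]_(x in `[0%R, +oo[) (2 `^ r * (1 + x) `^ (- (2 * r)))%:E)%E).
  apply: ge0_le_integral => //.
  - by move=> x _; rewrite lee_fin powR_ge0.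
  - by apply/measurable_EFinP/measurable_funTS; exact: continuous_measurable_fun.
  - apply/measurable_EFinP/measurable_funTS; apply: measurable_funM; first exact: measurable_cst.
    apply: (measurableT_comp (measurable_powR _)) => //.
    by apply: measurable_funD => //; exact: measurable_cst.
  move=> x; rewrite /= in_itv/= andbT => x0; rewrite lee_fin.
  have -> : (1 + x) `^ (- (2 * r)) = ((1 + x) ^+ 2) `^ (- r).
    by rewrite -powR_mulrn ?addr_ge0// -powRrM mulrN.
  have x2 : 0 < 1 + x ^+ 2 by [].
  have -> : 1 + x ^+ 2 = 2^-1 * (2 * (1 + x ^+ 2)) by field.
  have x3 : 0 < 2 * (1 + x ^+ 2) by rewrite mulr_gt0.
  have x4 : 0 < (1 + x) ^+ 2 by rewrite exprn_gt0// ltr_pwDl.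
  have x5 : (1 + x) ^+ 2 <= 2 * (1 + x ^+ 2).
    rewrite -subr_ge0 (_ : _ - _ = (1 - x) ^+ 2) ?sqr_ge0//; ring.
  rewrite powRM ?invr_ge0 ?(ltW x3)//.
  have -> : 2^-1 `^ (- r) = 2 `^ r :> R by rewrite -powR_inv1// -powRrM mulN1r opprK.
  rewrite ler_pM2l ?powR_gt0// !powRN lef_pV2 ?posrE ?powR_gt0//.
  by rewrite ge0_ler_powR ?nnegrE ?(ltW x3) ?(ltW x4)//; lra.
under eq_integral do rewrite EFinM.
rewrite ge0_integralZl_EFin ?powR_ge0//; first last.
- apply/measurable_EFinP/measurable_funTS.
  apply: (measurableT_comp (measurable_powR _)) => //.
  by apply: measurable_funD => //; exact: measurable_cst.
- by move=> x _; rewrite lee_fin powR_ge0.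
by rewrite lte_mul_pinfty ?lee_fin ?powR_ge0// powRN_1D_integral_lty//; lra.
Qed.

(** * Sobolev norm of a combination of three peaks *)

(** The left side is 4 sin^2(z / 2), and |sin y| <= |y| by the mean value theorem. *)
Lemma two_sub_2cos_le_sqr (R : realType) (z : R) : 2 - 2 * cos z <= z ^+ 2.
Proof.
pose s := sin (z / 2).
have -> : 2 - 2 * cos z = 4 * s ^+ 2.
  by rewrite /s sin2cos2 {1}(_ : z = (z / 2) *+ 2) ?cos_mulr2n; [ring|rewrite mulr2n; lra].
suff hs (y : R) : 0 <= y -> sin y ^+ 2 <= y ^+ 2.
  have : s ^+ 2 <= (z / 2) ^+ 2; last by lra.
  have [z0|z0] := leP 0 (z / 2); first exact: hs.
  by rewrite -[leRHS]sqrrN -[leLHS]sqrrN -sinN hs// oppr_ge0 ltW.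
move=> y0; rewrite -[leRHS]ger0_norm ?sqr_ge0// -[leLHS]ger0_norm ?sqr_ge0//.
rewrite !normrX lerXn2r ?nnegrE// [leRHS]ger0_norm//.
have [|c _] := @MVT_segment R sin cos 0 y y0.
  by apply: continuous_subspaceT; exact: continuous_sin.
by rewrite sin0 !subr0 => ->; rewrite normrM (ger0_norm y0) ler_piMl// cos_max.
Qed.

Lemma fourier_peakons (R : realType) (p1 p2 w q1 q2 z xi : R) :
  let f x := p1 * expR (- `|x - q1|) + p2 * expR (- `|x - q2|) - w * expR (- `|x - z|) in
  fourier f xi =
  ((2 / (1 + xi ^+ 2) * (p1 * cos (q1 * xi) + p2 * cos (q2 * xi) - w * cos (z * xi))) +i*
   (- (2 / (1 + xi ^+ 2) * (p1 * sin (q1 * xi) + p2 * sin (q2 * xi) - w * sin (z * xi)))))%C.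
Proof.
move=> f.
pose J (g : R -> R) := Rintegral (@lebesgue_measure R) setT g.
have icos q phi : (@lebesgue_measure R).-integrable setT (EFin \o (fun x => expR (- `|x - q|) * cos (x * xi + phi))).
  exact: expR_norm_cos_integrable.
(* One computation with a free phase serves both components: [phi = 0] gives the real part and
   [phi = pi / 2] the imaginary part. *)
have lin phi : J (fun x => f x * cos (x * xi + phi)) =
    2 / (1 + xi ^+ 2) * (p1 * cos (q1 * xi + phi) + p2 * cos (q2 * xi + phi) - w * cos (z * xi + phi)).
  pose g q (x : R) : R := expR (- `|x - q|) * cos (x * xi + phi).
  have iZ c q : (@lebesgue_measure R).-integrable setT (EFin \o (fun x => c * g q x)).
    by have := integrableZl measurableT c (icos q phi); apply: eq_integrable.
  rewrite /J (_ : (fun x => _) = (fun x => p1 * g q1 x + p2 * g q2 x + (- w) * g z x)); last first.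
    by apply/funext => x; rewrite /f /g; ring.
  have i12 : (@lebesgue_measure R).-integrable setT (EFin \o (fun x => p1 * g q1 x + p2 * g q2 x)).
    by have := integrableD measurableT (iZ p1 q1) (iZ p2 q2); apply: eq_integrable.
  rewrite RintegralD//.
  rewrite RintegralD// !RintegralZl//; try exact: icos.
  rewrite !expR_norm_cos_Rintegral; ring.
rewrite /fourier /Cintegral; congr (_ +i* _)%C.
- transitivity (J (fun x => f x * cos (x * xi + 0))); last by rewrite lin !addr0.
  by apply: eq_Rintegral => x _ /=; rewrite addr0 mul0r subr0.
- (* the phase pi / 2 turns the cosine into - sin *)
  have := lin (pi / 2); rewrite !cosDpihalf !mulrN -!opprD -mulrN => h.
  rewrite (_ : - (_ * _) = J (fun x => f x * cos (x * xi + pi / 2))); last by rewrite h; ring.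
  by apply: eq_Rintegral => x _ /=; rewrite cosDpihalf mul0r addr0.
Qed.

(** The left side is 2 - 2 cos((x - y) xi), which is at most 4 and at most A = (x - y)^2 (1 + xi^2).
    For A >= 1 use 4 <= 4 A^theta; for 0 < A < 1 use A <= A^theta. Having 1 + xi^2 in place of xi^2
    lets the factor merge with the Sobolev weight. *)
Lemma dist_cis_le (R : realType) (x y xi theta : R) : 0 <= theta <= 1 ->
  (cos (x * xi) - cos (y * xi)) ^+ 2 + (sin (x * xi) - sin (y * xi)) ^+ 2
  <= 4 * ((x - y) ^+ 2) `^ theta * (1 + xi ^+ 2) `^ theta.
Proof.
move=> /andP[th0 th1].
have -> : (cos (x * xi) - cos (y * xi)) ^+ 2 + (sin (x * xi) - sin (y * xi)) ^+ 2
    = 2 - 2 * cos ((x - y) * xi).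
  rewrite mulrBl cosB; have := cos2Dsin2 (x * xi); have := cos2Dsin2 (y * xi).
  move: (cos _) (cos _) (sin _) (sin _) => *; lra.
have h1 := two_sub_2cos_le_sqr R ((x - y) * xi).
have h2 : 2 - 2 * cos ((x - y) * xi) <= 4 by have := cos_geN1 ((x - y) * xi); lra.
rewrite -mulrA -powRM ?sqr_ge0 ?addr_ge0 ?sqr_ge0//.
set A := (x - y) ^+ 2 * (1 + xi ^+ 2).
have A0 : 0 <= A by rewrite mulr_ge0 ?addr_ge0 ?sqr_ge0.
have hA : 2 - 2 * cos ((x - y) * xi) <= A.
  rewrite (le_trans h1)// /A exprMn ler_wpM2l ?sqr_ge0// lerDr//.
have [A1|A1] := leP 1 A.
  rewrite (le_trans h2)// ler_peMr//.
  by rewrite -(powRr0 A) ler_powR.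
have [->|An0] := eqVneq (2 - 2 * cos ((x - y) * xi)) 0; first by rewrite mulr_ge0 ?powR_ge0.
have Ap : 0 < A.
  rewrite lt_neqAle A0 andbT; apply/negP => /eqP A00; move: hA; rewrite -A00.
  have := cos_le1 ((x - y) * xi) => hc h; move/eqP: An0; apply; lra.
rewrite (le_trans hA)// (@le_trans _ _ (A `^ theta))//; last by rewrite ler_peMl ?powR_ge0//; lra.
by rewrite ger1_powR// Ap ltW.
Qed.

(** [M] is chosen before the amplitudes and positions, so one constant serves all times as t tends
    to T. *)
Lemma Hs_norm_le (R : realType) (s theta : R) : 0 <= theta <= 1 -> s + theta < 3 / 2 ->
  exists2 M : R, 0 <= M & forall p1 p2 w q1 q2 z : R,
  (Hs_norm s (fun x => p1 * expR (- `|x - q1|) + p2 * expR (- `|x - q2|)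
      - w * expR (- `|x - z|))%R <=
   (Num.sqrt (M * ((p1 + p2 - w) ^+ 2 + w ^+ 2 * ((q1 - z) ^+ 2) `^ theta
      + p2 ^+ 2 * ((q2 - q1) ^+ 2) `^ theta)))%R%:E)%E.
Proof.
move=> hth hs; pose r := 2 - s - theta.
have r2 : 2^-1 < r by rewrite /r; lra.
have If := powRN_1Dsqr_integral_lty R r r2.
pose I := (\int[@lebesgue_measure R]_x ((1 + x ^+ 2) `^ (- r))%:E)%E.
have I0 : (0 <= I)%E by apply: integral_ge0 => x _; rewrite lee_fin powR_ge0.
have Ifin : I \is a fin_num by rewrite ge0_fin_numE.
(* 48 = 4 * 3 * 4: the squared 2 of the transform, the constant of [sq3], and the 4 of
   [dist_cis_le]. *)
exists (48 * fine I); first by rewrite mulr_ge0 ?fine_ge0.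
move=> p1 p2 w q1 q2 z.
set D := (X in 48 * fine I * X).
have D0 : 0 <= D.
  by rewrite /D; apply: addr_ge0; [apply: addr_ge0; [exact: sqr_ge0|]|]; rewrite mulr_ge0 ?sqr_ge0 ?powR_ge0.
have pos (x : R) : 0 < 1 + x ^+ 2 by rewrite ltr_pwDl// sqr_ge0.
pose A xi := p1 * cos (q1 * xi) + p2 * cos (q2 * xi) - w * cos (z * xi).
pose B xi := p1 * sin (q1 * xi) + p2 * sin (q2 * xi) - w * sin (z * xi).
pose g xi := 4 * (1 + xi ^+ 2) `^ (s - 2) * (A xi ^+ 2 + B xi ^+ 2).
have -> : Hs_norm s (fun x => p1 * expR (- `|x - q1|) + p2 * expR (- `|x - q2|)
      - w * expR (- `|x - z|)) = ((\int[@lebesgue_measure R]_xi (g xi)%:E) `^ 2^-1)%E.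
  rewrite /Hs_norm; congr (_ `^ _)%E; apply: eq_integral => xi _.
  rewrite fourier_peakons -/(A xi) -/(B xi) /= sqr_sqrtr ?addr_ge0 ?sqr_ge0//.
  congr EFin; rewrite /g powRB; last by apply/implyP => _; rewrite gt_eqF.
  rewrite powR_mulrn ?ltW//; field; rewrite gt_eqF//.
have cAB : continuous (fun xi : R => A xi ^+ 2 + B xi ^+ 2).
  by move=> x; apply: differentiable_continuous; exact/derivable1_diffP/ex_derive.
have cg : continuous g.
  move=> x; apply: cvgM; last exact: cAB.
  by apply: cvgM; [exact: cvg_cst|exact: continuous_1Dsqr_powR].
have gle x : g x <= 48 * D * (1 + x ^+ 2) `^ (- r).
  pose X := (1 + x ^+ 2) `^ theta.
  (* This lets the amplitude term, which carries no factor [X], share the weight of the two phase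
     terms. *)
  have X1 : 1 <= X.
    have : 1 `^ theta <= X; last by rewrite powR1.
    have /andP[th0 _] := hth.
    by rewrite ge0_ler_powR ?nnegrE ?lerDl ?sqr_ge0// (ltW (pos x)).
  have h1 := dist_cis_le R q1 z x theta hth.
  have h2 := dist_cis_le R q2 q1 x theta hth.
  rewrite -/X in h1 h2.
  have -> : (1 + x ^+ 2) `^ (- r) = (1 + x ^+ 2) `^ (s - 2) * X.
    rewrite -powRD; last by apply/implyP => _; rewrite gt_eqF.
    by congr (_ `^ _); rewrite /r; ring.
  rewrite /g -mulrA [leRHS](_ : _ = 4 * ((1 + x ^+ 2) `^ (s - 2) * (12 * D * X))); last by ring.
  rewrite ler_pM2l// ler_wpM2l ?powR_ge0//.
  have sq3 (u v t : R) : (u + v + t) ^+ 2 <= 3 * (u ^+ 2 + v ^+ 2 + t ^+ 2).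
    have := sqr_ge0 (u - v); have := sqr_ge0 (v - t); have := sqr_ge0 (u - t); nra.
  have hA := sq3 ((p1 + p2 - w) * cos (q1 * x)) (w * (cos (q1 * x) - cos (z * x)))
    (p2 * (cos (q2 * x) - cos (q1 * x))).
  have hB := sq3 ((p1 + p2 - w) * sin (q1 * x)) (w * (sin (q1 * x) - sin (z * x)))
    (p2 * (sin (q2 * x) - sin (q1 * x))).
  rewrite [X in X ^+ 2 <= _](_ : _ = A x) in hA; last by rewrite /A; ring.
  rewrite [X in X ^+ 2 <= _](_ : _ = B x) in hB; last by rewrite /B; ring.
  apply: (le_trans (lerD hA hB)).
  have -> : 3 * (((p1 + p2 - w) * cos (q1 * x)) ^+ 2 + (w * (cos (q1 * x) - cos (z * x))) ^+ 2 +
     (p2 * (cos (q2 * x) - cos (q1 * x))) ^+ 2) +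
    3 * (((p1 + p2 - w) * sin (q1 * x)) ^+ 2 + (w * (sin (q1 * x) - sin (z * x))) ^+ 2 +
     (p2 * (sin (q2 * x) - sin (q1 * x))) ^+ 2) =
    3 * ((p1 + p2 - w) ^+ 2 * (cos (q1 * x) ^+ 2 + sin (q1 * x) ^+ 2)
     + w ^+ 2 * ((cos (q1 * x) - cos (z * x)) ^+ 2 + (sin (q1 * x) - sin (z * x)) ^+ 2)
     + p2 ^+ 2 * ((cos (q2 * x) - cos (q1 * x)) ^+ 2 + (sin (q2 * x) - sin (q1 * x)) ^+ 2)) by ring.
  rewrite cos2Dsin2 mulr1.
  have k1 := ler_wpM2l (sqr_ge0 w) h1.
  have k2 := ler_wpM2l (sqr_ge0 p2) h2.
  have k3 : (p1 + p2 - w) ^+ 2 <= (p1 + p2 - w) ^+ 2 * X by rewrite ler_peMr ?sqr_ge0.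
  have k4 : 0 <= (p1 + p2 - w) ^+ 2 by exact: sqr_ge0.
  rewrite /D; lra.
have intle : (\int[@lebesgue_measure R]_xi (g xi)%:E <= (48 * fine I * D)%:E)%E.
  rewrite (_ : (48 * fine I * D)%:E = ((48 * D)%:E * I)%E); last first.
    by rewrite -[in RHS](fineK Ifin) -EFinM; congr EFin; ring.
  have -> : ((48 * D)%:E * I = \int[@lebesgue_measure R]_x (48 * D * (1 + x ^+ 2) `^ (- r))%:E)%E.
    under eq_integral do rewrite EFinM.
    rewrite ge0_integralZl_EFin//.
    - by move=> x _; rewrite lee_fin powR_ge0.
    - apply/measurable_EFinP; apply: continuous_measurable_fun.
      exact: continuous_1Dsqr_powR.
    - by rewrite mulr_ge0.
  apply: ge0_le_integral => //.
  - by move=> x _; rewrite lee_fin /g mulr_ge0 ?addr_ge0 ?sqr_ge0// mulr_ge0 ?powR_ge0.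
  - by apply/measurable_EFinP; exact: continuous_measurable_fun.
  - apply/measurable_EFinP; apply: continuous_measurable_fun => x.
    by apply: cvgM; [exact: cvg_cst|exact: continuous_1Dsqr_powR].
  by move=> x _; rewrite lee_fin gle.
apply: (@le_trans _ _ ((48 * fine I * D)%:E `^ 2^-1)%E).
  apply: gt0_ler_poweR => //.
  - rewrite in_itv/= leey andbT; apply: integral_ge0 => x _.
    by rewrite lee_fin mulr_ge0 ?addr_ge0 ?sqr_ge0// mulr_ge0 ?powR_ge0.
  - by rewrite in_itv/= leey andbT lee_fin !mulr_ge0 ?fine_ge0.
by rewrite poweR_EFin powR12_sqrt ?mulr_ge0 ?fine_ge0.
Qed.

(** * From derivatives within [[0, T[] to mean values and limits *)

(** Near an interior point the restriction to [[0, T[] excludes nothing. The slope function, given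
    the value [l] at [t], is the Caratheodory witness. *)
Lemma has_derivative_in_is_derive (R : realType) (T : R) (f : R -> R) (t l : R) :
  0 < t < T -> has_derivative_in `[0, T[ f t l -> is_derive t 1 f l.
Proof.
move=> /andP[t0 tT] H; apply/is_derive1_caratheodory.
exists (fun z => if z == t then l else (f z - f t) / (z - t)); split.
- move=> z; case: eqP => [->|/eqP]; first by rewrite !subrr mulr0.
  by rewrite -subr_eq0 => /divfK->.
- apply/continuous_withinNx; rewrite /= eqxx.
  move=> A /H; rewrite /= /nbhs /= /within /= => hA.
  have h0 : \forall x \near t^', 0 < x by apply: nbhs_dnbhs; exact: lt_nbhsr.
  have hT : \forall x \near t^', x < T by apply: nbhs_dnbhs; exact: lt_nbhsl.
  apply: filter_app hA; near=> x => hA.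
  have xt : x != t by near: x; exact: nbhs_dnbhs_neq.
  rewrite /preimage /=  (negbTE xt); apply: hA => //.
  by rewrite in_itv/=; apply/andP; split; [apply/ltW; near: x|near: x].
- by rewrite eqxx.
Unshelve. all: by end_near. Qed.

(** Near 0, [f r] is the slope times [r] plus [f 0], and the slope has a finite limit. *)
Lemma has_derivative_in_continuous_right (R : realType) (T : R) (f : R -> R) (l : R) :
  0 < T -> has_derivative_in `[0, T[ f 0 l -> f x @[x --> 0^'+] --> f 0.
Proof.
move=> T0 H.
have H1 : (f r - f 0) / (r - 0) @[r --> 0^'+] --> l.
  apply: cvg_trans H; apply: cvg_app => A /=.
  rewrite /at_right /within /dnbhs /within /= /nbhs /= => hA.
  have hT : \forall x \near (0:R), x < T by exact: lt_nbhsl.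
  near=> x => x0.
  have xT : x < T by near: x.
  have : x != 0 -> x \in `[0, T[ -> A x by near: x.
  by apply; rewrite ?gt_eqF// in_itv/= (ltW x0).
have H2 : (f r - f 0) / (r - 0) * r + f 0 @[r --> 0^'+] --> l * 0 + f 0.
  apply: cvgD; last exact: cvg_cst.
  by apply: cvgM => //; apply: cvg_at_right_filter; exact: cvg_id.
rewrite mulr0 add0r in H2; apply: cvg_trans H2; apply: near_eq_cvg.
near=> x; have x0 : 0 < x by near: x; exact: nbhs_right_gt.
by rewrite subr0 divfK ?gt_eqF// subrK.
Unshelve. all: by end_near. Qed.

(** The hypotheses match what the system supplies: two-sided derivatives inside and right continuity
    at 0. The closed range of [c] covers [t = 0]. *)
Lemma MVT_from_0 (R : realType) (T t : R) (f df : R -> R) :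
  (forall x, 0 < x < T -> is_derive x 1 f (df x)) -> f x @[x --> 0^'+] --> f 0 ->
  0 <= t < T -> exists2 c, 0 <= c <= t & f t - f 0 = df c * t.
Proof.
move=> dF f0 /andP[]; rewrite le_eqVlt => /predU1P[<- _|t0 tT].
  by exists 0; rewrite ?lexx// mulr0 subrr.
have cf : {within `[0, t], continuous f}.
  apply: derivable_oo_LRcontinuous_within; split => //.
    by move=> x; rewrite in_itv/= => /andP[x0 xt]; apply: ex_derive; apply: dF; rewrite x0 (lt_trans xt).
  apply: cvg_at_left_filter; apply: differentiable_continuous.
  by apply/derivable1_diffP; apply: ex_derive; apply: dF; rewrite t0.
have [|c] := @MVT R f df 0 t t0 _ cf.
  by move=> x; rewrite in_itv/= => /andP[x0 xt]; apply: dF; rewrite x0 (lt_trans xt).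
rewrite in_itv/= => /andP[c0 ct]; rewrite subr0 => ->; exists c => //.
by rewrite !ltW.
Qed.

(** A positive limit of f^2 keeps [f] away from 0 near T, so its sign is constant there by the
    intermediate value theorem, and [f] is that sign times the square root of f^2. *)
Lemma sqr_cvg_is_cvg (R : realType) (t0 T H : R) (f : R -> R) :
  t0 < T -> (forall x, t0 < x < T -> {for x, continuous f}) ->
  0 < H -> f x ^+ 2 @[x --> T^'-] --> H -> exists l : R, f x @[x --> T^'-] --> l.
Proof.
move=> t0T cf H0 fH.
have nf0 : \forall x \near T^'-, 0 < f x ^+ 2 by exact: (cvgr_gt H fH).
have [m mT fm] : exists2 m, t0 < m < T & forall x, m <= x < T -> f x != 0.
  move: nf0 => [e /= e0 he].
  (* The midpoint keeps [m] above [t0]; the other entry puts [[m, T[] inside the [e]-ball around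
     T. *)
  exists (Num.max ((t0 + T) / 2) (T - e / 2)).
    by apply/andP; split; [rewrite lt_max|rewrite gt_max]; lra.
  move=> x; rewrite ge_max => /andP[/andP[h1 h2] xT].
  have := he x; rewrite /= ger0_norm; last lra.
  by move=> /(_ _ xT); rewrite exprn_even_gt0//=; apply; lra.
have sgf x : m < x < T -> 0 < f m * f x.
  move=> /andP[mx xT]; rewrite ltNge; apply/negP => fmx.
  have cab : {within `[m, x], continuous f}.
    apply: continuous_in_subspaceT => y; rewrite inE/= in_itv/= => /andP[my yx].
    by apply: cf; lra.
  have [||y] := @IVT R f m x 0 _ cab.
  - exact: ltW.
  - by rewrite ge_min le_max; nra.
  - rewrite in_itv/= => /andP[my yx] fy0; have := fm y; rewrite fy0 eqxx.
    by rewrite my (le_lt_trans yx xT) => /(_ isT).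
have fE x : m < x < T -> f x = Num.sg (f m) * Num.sqrt (f x ^+ 2).
  move=> hx; have := sgf x hx; rewrite sqrtr_sqr.
  have [fm0|fm0|->] := ltrgt0P (f m); last by rewrite mul0r ltxx.
  - by rewrite pmulr_rgt0// gtr0_sg// mul1r => /gtr0_norm ->.
  - by rewrite nmulr_rgt0// ltr0_sg// mulN1r => /ltr0_norm ->; rewrite opprK.
exists (Num.sg (f m) * Num.sqrt H).
have : Num.sg (f m) * Num.sqrt (f x ^+ 2) @[x --> T^'-] --> Num.sg (f m) * Num.sqrt H.
  apply: cvgM; first exact: cvg_cst.
  by apply: (continuous_cvg _ _ fH); exact: sqrt_continuous.
apply: cvg_trans; apply: near_eq_cvg; near=> x.
rewrite -fE//; apply/andP; split; near: x; first by apply: nbhs_left_gt; lra.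
exact: nbhs_left_lt.
Unshelve. all: by end_near. Qed.

(** * Conservation laws of the 2-peakon system and limits at the collision *)

Section peakon_pair.
Context {R : realType} {a b delta T : R} {q1 q2 p1 p2 : R -> R}.
Context (hu : is_peakon_pair a b delta T q1 q2 p1 p2).

Let E t := expR (- (q2 t - q1 t)).

Let is_derive_q1 t : 0 < t < T -> is_derive t 1 q1 ((p1 t + p2 t * E t) ^+ 2).
Proof.
move=> /[dup] /andP[/ltW t0 tT] ht; apply: has_derivative_in_is_derive ht _.
by apply: (peakon_dq1 hu); rewrite t0.
Qed.

Let is_derive_q2 t : 0 < t < T -> is_derive t 1 q2 ((p1 t * E t + p2 t) ^+ 2).
Proof.
move=> /[dup] /andP[/ltW t0 tT] ht; apply: has_derivative_in_is_derive ht _.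
by apply: (peakon_dq2 hu); rewrite t0.
Qed.

Let is_derive_p1 t : 0 < t < T ->
  is_derive t 1 p1 (- p1 t * p2 t * (p1 t + p2 t * E t) * E t).
Proof.
move=> /[dup] /andP[/ltW t0 tT] ht; apply: has_derivative_in_is_derive ht _.
by apply: (peakon_dp1 hu); rewrite t0.
Qed.

Let is_derive_p2 t : 0 < t < T ->
  is_derive t 1 p2 (p1 t * p2 t * (p1 t * E t + p2 t) * E t).
Proof.
move=> /[dup] /andP[/ltW t0 tT] ht; apply: has_derivative_in_is_derive ht _.
by apply: (peakon_dp2 hu); rewrite t0.
Qed.

Let is_derive_E t : 0 < t < T ->
  is_derive t 1 E ((p1 t ^+ 2 - p2 t ^+ 2) * (1 - E t ^+ 2) * E t).
Proof.
(* In q1' - q2' the cross terms 2 p1 p2 E cancel. *)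
move=> ht; have := is_derive_q1 t ht; have := is_derive_q2 t ht => d2 d1.
by apply: is_derive_eq; rewrite /GRing.scale/= -/(E t); ring.
Qed.

Let T_gt0 : 0 < T := peakon_lifespan_gt0 hu.

Let right0 : 0 <= (0 : R) < T.
Proof. by rewrite lexx/= T_gt0. Qed.

Let cvg_q1 : q1 x @[x --> 0^'+] --> q1 0.
Proof. exact: (has_derivative_in_continuous_right _ _ _ _ T_gt0 (peakon_dq1 hu right0)). Qed.

Let cvg_q2 : q2 x @[x --> 0^'+] --> q2 0.
Proof. exact: (has_derivative_in_continuous_right _ _ _ _ T_gt0 (peakon_dq2 hu right0)). Qed.

Let cvg_p1 : p1 x @[x --> 0^'+] --> p1 0.
Proof. exact: (has_derivative_in_continuous_right _ _ _ _ T_gt0 (peakon_dp1 hu right0)). Qed.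

Let cvg_p2 : p2 x @[x --> 0^'+] --> p2 0.
Proof. exact: (has_derivative_in_continuous_right _ _ _ _ T_gt0 (peakon_dp2 hu right0)). Qed.

Let cvg_E : E x @[x --> 0^'+] --> E 0.
Proof.
have h : - (q2 x - q1 x) @[x --> 0^'+] --> - (q2 0 - q1 0) by apply: cvgN; apply: cvgB.
by apply: cvg_trans (cvg_app expR h) _; exact: continuous_expR.
Qed.

Let E_0 : E 0 = expR (- (2 * a)).
Proof. by rewrite /E (peakon_q1_0 hu) (peakon_q2_0 hu); congr expR; ring. Qed.

(** This is a constant multiple of the squared H^1 norm of the 2-peakon; its derivative vanishes
    identically along the system. *)
Lemma energy_conserved t : 0 <= t < T ->
  p1 t ^+ 2 + p2 t ^+ 2 + 2 * p1 t * p2 t * E t =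
  (b + delta) ^+ 2 + b ^+ 2 - 2 * (b + delta) * b * expR (- (2 * a)).
Proof.
move=> ht; pose G t := p1 t ^+ 2 + p2 t ^+ 2 + 2 * p1 t * p2 t * E t.
rewrite -/(G t); have : G 0 = (b + delta) ^+ 2 + b ^+ 2 - 2 * (b + delta) * b * expR (- (2 * a)).
  by rewrite /G E_0 (peakon_p1_0 hu) (peakon_p2_0 hu); ring.
move=> <-; have [||c _] := @MVT_from_0 R T t G (cst 0) _ _ ht.
- move=> x hx; have := is_derive_p1 x hx; have := is_derive_p2 x hx.
  have := is_derive_E x hx => dE d2 d1.
  by apply: is_derive_eq; rewrite /GRing.scale/=; ring.
- by apply: cvgD; [apply: cvgD; [apply: cvgM|apply: cvgM]|
    apply: cvgM => //; apply: cvgM => //; apply: cvgM => //; exact: cvg_cst].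
- by rewrite mul0r => /eqP; rewrite subr_eq0 => /eqP.
Qed.

(** With P = p1 p2 the system gives P' = P E^2 (p1^2 - p2^2), whose contribution cancels that of E'
    = (p1^2 - p2^2) (1 - E^2) E. *)
Lemma momentum_product_conserved t : 0 <= t < T ->
  (p1 t * p2 t) ^+ 2 * (1 - E t ^+ 2) =
  ((b + delta) * b) ^+ 2 * (1 - expR (- (2 * a)) ^+ 2).
Proof.
move=> ht; pose G t := (p1 t * p2 t) ^+ 2 * (1 - E t ^+ 2).
rewrite -/(G t); have : G 0 = ((b + delta) * b) ^+ 2 * (1 - expR (- (2 * a)) ^+ 2).
  by rewrite /G E_0 (peakon_p1_0 hu) (peakon_p2_0 hu); ring.
move=> <-; have [||c _] := @MVT_from_0 R T t G (cst 0) _ _ ht.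
- move=> x hx; have := is_derive_p1 x hx; have := is_derive_p2 x hx.
  have := is_derive_E x hx => dE d2 d1.
  by apply: is_derive_eq; rewrite /GRing.scale/=; ring.
- apply: cvgM; first by apply: cvgM; apply: cvgM.
  by apply: cvgB; [exact: cvg_cst|apply: cvgM].
- by rewrite mul0r => /eqP; rewrite subr_eq0 => /eqP.
Qed.

Lemma energy_gt0 : 0 < a -> 1 < b -> 0 < delta ->
  0 < (b + delta) ^+ 2 + b ^+ 2 - 2 * (b + delta) * b * expR (- (2 * a)).
Proof.
move=> a0 b1 d0; have : expR (- (2 * a)) <= 1 by rewrite expR_le1; lra.
move: (expR _) => e e1.
(* The right side is the stated value of w_T^2, a form in which positivity is visible. *)
have -> : (b + delta) ^+ 2 + b ^+ 2 - 2 * (b + delta) * b * e =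
  delta ^+ 2 + 2 * ((b + delta) * b) * (1 - e) by ring.
rewrite ltr_pwDl ?exprn_gt0// mulr_ge0//; nra.
Qed.

Let H := (b + delta) ^+ 2 + b ^+ 2 - 2 * (b + delta) * b * expR (- (2 * a)).
Let K := ((b + delta) * b) ^+ 2 * (1 - expR (- (2 * a)) ^+ 2).

Let E_lt1 t : 0 <= t < T -> 0 < E t < 1.
Proof.
by move=> ht; rewrite expR_gt0 expR_lt1 oppr_lt0 (peakon_gap_gt0 hu).
Qed.

Let near_dom : \forall t \near T^'-, 0 <= t < T.
Proof.
near=> t; apply/andP; split; near: t; last exact: nbhs_left_lt.
exact: nbhs_left_ge.
Unshelve. all: by end_near. Qed.

Let cvg_E1 : E t @[t --> T^'-] --> (1 : R).
Proof.
rewrite -[X in _ --> X](@expR0 R) -oppr0.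
have h : - (q2 t - q1 t) @[t --> T^'-] --> - (0 : R).
  by apply: cvgN; exact: (peakon_gap_cvg0 hu).
by apply: cvg_trans (cvg_app expR h) _; exact: continuous_expR.
Qed.

Lemma sqr_sum_cvg : (p1 t + p2 t) ^+ 2 @[t --> T^'-] --> H.
Proof.
(* By (1 - E)^2 <= (1 - E^2) (1 - E), the square of p1 p2 (1 - E) is at most K (1 - E). *)
have hK t : 0 <= t < T ->
    `|2 * p1 t * p2 t * (1 - E t)| <= 2 * Num.sqrt (K * (1 - E t)).
  move=> ht; have /andP[e0 e1] := E_lt1 t ht.
  have := momentum_product_conserved t ht; rewrite -/K => hK.
  have -> : 2 * p1 t * p2 t * (1 - E t) = 2 * (p1 t * p2 t * (1 - E t)) by ring.
  rewrite normrM (ger0_norm (ler0n R 2)) ler_pM2l// -sqrtr_sqr ler_sqrt -hK.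
    rewrite exprMn -mulrA ler_wpM2l ?sqr_ge0// -subr_ge0.
    have -> : (1 - E t ^+ 2) * (1 - E t) - (1 - E t) ^+ 2 = E t * (1 - E t) ^+ 2 by ring.
    by rewrite mulr_ge0 ?sqr_ge0// ltW.
  have e2 : 0 <= 1 - E t ^+ 2 by rewrite subr_ge0 expr_le1// ltW.
  have e3 : 0 <= 1 - E t by rewrite subr_ge0 ltW.
  by apply: mulr_ge0 => //; apply: mulr_ge0 => //; exact: sqr_ge0.
have h0 : 2 * p1 t * p2 t * (1 - E t) @[t --> T^'-] --> (0 : R).
  apply/norm_cvg0P.
  have h1 : 2 * Num.sqrt (K * (1 - E t)) @[t --> T^'-] --> (0 : R).
    rewrite -[X in _ --> X](mulr0 2) -sqrtr0 -(mulr0 K) -(subrr 1).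
    apply: cvgM; first exact: cvg_cst.
    have h : K * (1 - E t) @[t --> T^'-] --> K * (1 - 1).
      by apply: cvgM; [exact: cvg_cst|apply: cvgB => //; exact: cvg_cst].
    by apply: cvg_trans (cvg_app Num.sqrt h) _; exact: sqrt_continuous.
  apply: (@squeeze_cvgr _ _ _ _ (cst 0) (fun t => 2 * Num.sqrt (K * (1 - E t)))) => //; last exact: cvg_cst.
  by apply: filterS near_dom => t ht; rewrite normr_ge0/= hK.
have h : H + 2 * p1 t * p2 t * (1 - E t) @[t --> T^'-] --> H + 0.
  by apply: cvgD => //; exact: cvg_cst.
rewrite addr0 in h; apply: cvg_trans h; apply: near_eq_cvg.
apply: filterS near_dom => t ht.
by rewrite /H -(energy_conserved t ht); ring.
Qed.

(** As [peakon_wT] is a [lim], it is enough that some limit exists; positivity of [H] provides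
    it. *)
Lemma sum_cvg : 0 < a -> 1 < b -> 0 < delta ->
  p1 t + p2 t @[t --> T^'-] --> peakon_wT T p1 p2.
Proof.
move=> a0 b1 d0.
have [||l hl] := sqr_cvg_is_cvg R 0 T H (fun t => p1 t + p2 t) T_gt0 _ (energy_gt0 a0 b1 d0).
- move=> x hx; have := is_derive_p1 x hx; have := is_derive_p2 x hx => d2 d1.
  apply: differentiable_continuous; exact/derivable1_diffP/ex_derive.
- exact: sqr_sum_cvg.
by rewrite /peakon_wT (cvg_lim _ hl).
Qed.

(** [q1] is nondecreasing because its derivative is a square, and bounded above because that
    derivative is at most [H] on a bounded time interval. *)
Lemma q1_cvg : q1 t @[t --> T^'-] --> peakon_qT T q1.
Proof.
have dq x : 0 < x < T -> derivable q1 x 1.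
  by move=> hx; have := is_derive_q1 x hx => ?; exact: ex_derive.
apply: nondecreasing_at_left_is_cvgr.
  near=> c => x y; rewrite !in_itv/= => /andP[cx xT] /andP[cy yT] xy.
  have c0 : 0 < c by near: c; exact: nbhs_left_gt.
  have [||z] := @MVT_segment R q1 (fun t => (p1 t + p2 t * E t) ^+ 2) x y xy.
  - move=> z; rewrite in_itv/= => /andP[xz zy]; apply: is_derive_q1; lra.
  - apply: continuous_in_subspaceT => z; rewrite inE/= in_itv/= => /andP[xz zy].
    by apply: differentiable_continuous; apply/derivable1_diffP/dq; lra.
  by move=> _ h; rewrite -subr_ge0 h mulr_ge0 ?sqr_ge0// subr_ge0.
near=> c; exists (q1 0 + H * T) => _ /= [y + <-].
rewrite in_itv/= => /andP[cy yT].
have c0 : 0 < c by near: c; exact: nbhs_left_gt.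
have hy : 0 <= y < T by rewrite yT (le_trans (ltW c0) (ltW cy)).
have [z hz] := @MVT_from_0 R T y q1 (fun t => (p1 t + p2 t * E t) ^+ 2) is_derive_q1 cvg_q1 hy.
rewrite -lerBlDl => ->; have hz' : 0 <= z < T by lra.
have /andP[e0 e1] := E_lt1 z hz'.
(* the energy bounds the speed of q1 *)
have -> : H = (p1 z + p2 z * E z) ^+ 2 + p2 z ^+ 2 * (1 - E z ^+ 2).
  by rewrite /H -(energy_conserved z hz'); ring.
have : 0 <= p2 z ^+ 2 * (1 - E z ^+ 2) by rewrite mulr_ge0 ?sqr_ge0//; nra.
have := sqr_ge0 (p1 z + p2 z * E z); nra.
Unshelve. all: by end_near. Qed.

Lemma p2_gap_cvg0 (theta : R) : 4^-1 < theta ->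
  p2 t ^+ 2 * ((q2 t - q1 t) ^+ 2) `^ theta @[t --> T^'-] --> (0 : R).
Proof.
move=> th; pose q t := q2 t - q1 t.
have q_right0 : q t @[t --> T^'-] --> (0 : R)^'+.
  move=> A hA; have hA' := peakon_gap_cvg0 hu hA.
  apply: filterS2 near_dom hA' => t ht /=; apply; exact: (peakon_gap_gt0 hu).
have cvg_pow (e : R) : 0 < e -> q t `^ e @[t --> T^'-] --> (0 : R).
  by move=> e0; apply: cvg_trans (cvg_app (fun y : R => y `^ e) q_right0) _; exact: powR_cvg0.
(* The majorant comes from p2^2 <= (p1 + p2)^2 + (2K + 1) q^{-1/2}, valid once q < 1, times q^{2
   theta}. The exponent 2 theta - 1/2 is positive exactly when theta > 1/4. *)
have lim0 : (p1 t + p2 t) ^+ 2 * q t `^ (2 * theta)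
    + (2 * K + 1) * q t `^ (2 * theta - 2^-1) @[t --> T^'-] --> H * 0 + (2 * K + 1) * 0.
  apply: cvgD; apply: cvgM; [exact: sqr_sum_cvg|apply: cvg_pow; lra|exact: cvg_cst|apply: cvg_pow; lra].
rewrite !mulr0 addr0 in lim0.
apply: (squeeze_cvgr _ _ lim0); last exact: cvg_cst.
have near_le1 : \forall t \near T^'-, q t < 1.
  by apply: (cvgr_lt _ (peakon_gap_cvg0 hu)).
near=> t.
have ht : 0 <= t < T by near: t.
have qt1 : q t < 1 by near: t.
have qt0 : 0 < q t by exact: (peakon_gap_gt0 hu).
rewrite mulr_ge0 ?sqr_ge0 ?powR_ge0//= -/(q t) -(powR_mulrn 2 (ltW qt0)) -powRrM.
pose r := q t `^ 2^-1.
have r0 : 0 < r by rewrite powR_gt0.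
have rq : r ^+ 2 = q t by rewrite -powR_mulrn ?ltW// -powRrM mulVf// powRr1// ltW.
have -> : (2 * K + 1) * q t `^ (2 * theta - 2^-1) = (2 * K + 1) / r * q t `^ (2 * theta).
  rewrite powRB; last by apply/implyP => _; rewrite gt_eqF.
  by rewrite -/r; ring.
rewrite -mulrDl ler_wpM2r ?powR_ge0//.
have /andP[e0 e1] := E_lt1 t ht.
have hK := momentum_product_conserved t ht; rewrite -/K in hK.
(* For q < 1 this yields 1 - E^2 >= 1 - E >= q / (1 + q) >= q / 2, hence P^2 q <= 2K below. *)
have Eq : E t * (1 + q t) <= 1.
  by rewrite /E expRN ler_pdivrMl ?expR_gt0// mulr1 expR_ge1Dx.
(* p2^2 <= (p1 + p2)^2 - 2 p1 p2, and AM-GM: - 2 P <= P^2 r + 1 / r with r = sqrt q *)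
pose P := p1 t * p2 t.
have PK : P ^+ 2 * q t <= 2 * K.
  rewrite -hK -/P mulrCA ler_wpM2l ?sqr_ge0//; nra.
have Pr : P ^+ 2 * r + r^-1 <= (2 * K + 1) / r.
  by rewrite ler_pdivlMr// mulrDl mulVf ?gt_eqF// lerD2r -mulrA -expr2 rq.
apply: le_trans (_ : (p1 t + p2 t) ^+ 2 + (P ^+ 2 * r + r^-1) <= _); last by rewrite lerD2l.
have AG : - (2 * P) <= P ^+ 2 * r + r^-1.
  rewrite -subr_ge0.
  have -> : P ^+ 2 * r + r^-1 - - (2 * P) = r * (P + r^-1) ^+ 2 by field; rewrite gt_eqF.
  by rewrite mulr_ge0 ?sqr_ge0// ltW.
have := sqr_ge0 (p1 t + p2 t - p2 t); rewrite /P in AG *; nra.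
Unshelve. all: by end_near. Qed.

End peakon_pair.

(** * Convergence in the Sobolev norm *)

(** [f] may take the value 0, as (q1 - q_T)^2 might, so a limit from the right at 0 does not apply;
    f < eps^{1/e} gives f^e <= eps directly. *)
Lemma cvg0_powR {U : Type} {F : set_system U} {FF : Filter F} (R : realType)
    (f : U -> R) (e : R) : 0 < e -> (forall x, 0 <= f x) ->
  f x @[x --> F] --> (0 : R) -> f x `^ e @[x --> F] --> (0 : R).
Proof.
move=> e0 f0 fF; apply/cvgrPdist_le => eps eps0.
have d0 : 0 < eps `^ e^-1 by rewrite powR_gt0.
near=> x; have fx : f x < eps `^ e^-1 by near: x; exact: cvgr_lt fF _ d0.
rewrite sub0r normrN ger0_norm ?powR_ge0//.
rewrite (_ : eps = (eps `^ e^-1) `^ e); last first.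
  by rewrite -powRrM mulVf ?gt_eqF// powRr1// ltW.
by rewrite ge0_ler_powR ?nnegrE ?powR_ge0// ltW.
Unshelve. all: by end_near. Qed.

Theorem theorem5 (R : realType) (a b delta T : R) (q1 q2 p1 p2 : R -> R)
    (ha0 : 0 < a) (ha : a <= 1 / 4) (hb : 1 < b) (hdelta : 0 < delta)
    (hu : is_peakon_pair a b delta T q1 q2 p1 p2) (s : R) (hs : s < 5 / 4) :
  Hs_norm s (fun x => peakon2 q1 q2 p1 p2 t x - limit_profile T q1 p1 p2 x)
    @[t --> T^'-] --> (0 : \bar R)%E.
Proof.
have [theta /andP[th14 th1] hsth] : exists2 theta, 4^-1 < theta <= 1 & s + theta < 3 / 2.
  (* The midpoint of the admissible range from 1/4 to 3/2 - s, or 1/2 when that midpoint exceeds 1,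
     that is when s < -1/4. *)
  have [s1|s1] := leP ((7 / 4 - s) / 2) 1; last by exists 2^-1; lra.
  by exists ((7 / 4 - s) / 2); lra.
have [|M M0 hM] := Hs_norm_le R s theta _ hsth; first lra.
set w := peakon_wT T p1 p2; set z := peakon_qT T q1.
pose D t := (p1 t + p2 t - w) ^+ 2 + w ^+ 2 * ((q1 t - z) ^+ 2) `^ theta
  + p2 t ^+ 2 * ((q2 t - q1 t) ^+ 2) `^ theta.
have cvgD0 : D t @[t --> T^'-] --> (0 : R).
  have -> : (0 : R) = 0 * 0 + w ^+ 2 * 0 + 0 by ring.
  apply: cvgD; last exact: (p2_gap_cvg0 hu).
  have hS : p1 t + p2 t - w @[t --> T^'-] --> (0 : R).
    by rewrite -(subrr w); apply: cvgB; [exact: (sum_cvg hu)|exact: cvg_cst].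
  have hq : q1 t - z @[t --> T^'-] --> (0 : R).
    by rewrite -(subrr z); apply: cvgB; [exact: (q1_cvg hu)|exact: cvg_cst].
  apply: cvgD; first exact: cvgM.
  apply: cvgM; first exact: cvg_cst.
  apply: cvg0_powR; first lra.
  - by move=> t; exact: sqr_ge0.
  - by rewrite -[X in _ --> X](mulr0 0); exact: cvgM.
have cvgN0 : Num.sqrt (M * D t) @[t --> T^'-] --> (0 : R).
  have h : M * D t @[t --> T^'-] --> M * 0 by apply: cvgM => //; exact: cvg_cst.
  rewrite -sqrtr0 -(mulr0 M).
  by apply: cvg_trans (cvg_app Num.sqrt h) _; exact: sqrt_continuous.
apply: (@squeeze_cvge _ _ _ _ (cst 0%E) _ (fun t => (Num.sqrt (M * D t))%:E)).
- by apply: nearW => t; rewrite poweR_ge0/=; exact: hM.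
- exact: cvg_cst.
- by apply: cvg_EFin => //; exact: nearW.
Qed.
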